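(* Let $G$ be a connected graph and let $D\subseteq V(G)$ be a connected $3$-way dominating set of $G$. Then $px_3(G)\le px_3(G[D])+3$. Moreover, this bound is tight: for every integer $p\ge 3$ and integers $i_1,\dots,i_p\ge 4$, the graph $G$ obtained from complete graphs $K_{i_1},\dots,K_{i_p}$ by identifying one vertex of each into a single common vertex $v_0$ has the connected $3$-way dominating set $D=\{v_0\}$ and satisfies $px_3(G)=3=px_3(G[D])+3$.
   Context: All graphs are finite, simple and undirected. For $D\subseteq V(G)$, $\overline{D}=V(G)\setminus D$ and $G[D]$ is the induced subgraph. A set $D$ is a dominating set if every vertex of $\overline{D}$ has a neighbor in $D$; it is a $3$-way dominating set if moreover every vertex $v\in\overline{D}$ has degree $d(v)\ge 3$ in $G$; it is connected if $G[D]$ is connected. An edge-coloring assigns colors to edges, adjacent edges being allowed to share a color. A tree in an edge-colored graph is a proper tree if no two adjacent edges of it receive the same color. For a set $S$ of vertices, an $S$-tree is a tree containing all vertices of $S$. An edge-coloring of a connected graph $H$ is a $3$-proper coloring if for every $3$-element subset $S\subseteq V(H)$ there is a proper $S$-tree in $H$; $px_3(H)$ is the minimum number of colors in such a coloring. For a connected graph $H$ with fewer than $3$ vertices, we use the convention that $px_3(H)$ is the minimum number of colors needed to color its edges so that any set of its vertices is contained in a proper tree (so $px_3(K_1)=0$, $px_3(K_2)=1$). *)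

(* Defs.v *)
(* Finite simple graphs as symmetric irreflexive relations. *)
From mathcomp Require Import all_boot.
Set Implicit Arguments. Unset Strict Implicit. Unset Printing Implicit Defensive.

Section Graphs.
Variable T : finType.
Variable e : rel T.

Definition connected_graph : Prop :=
  0 < #|T| /\ forall x y : T, connect e x y.

Definition induced_rel (D : {set T}) : rel T :=
  fun a b => [&& a \in D, b \in D & e a b].

Definition dominating (D : {set T}) : Prop :=
  forall v, v \notin D -> exists2 u, u \in D & e v u.

Definition three_way_dominating (D : {set T}) : Prop :=
  dominating D /\ forall v, v \notin D -> 3 <= #|[set u | e v u]|.

Definition connected_set (D : {set T}) : Prop :=
  D != set0 /\ forall x y, x \in D -> y \in D -> connect (induced_rel D) x y.

Definition is_edge (V : {set T}) (eps : {set T}) : bool :=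
  [exists x in V, exists y in V, e x y && (eps == [set x; y])].

(* Edge colorings: a color (a natural number below the palette size
   #|{set T}|, which is at least the number of edges) for every 2-set. *)
Definition palette := #|{set T}|.
Definition coloring := {ffun {set T} -> 'I_palette}.

Definition is_subtree (V : {set T}) (W : {set T}) (F : {set {set T}}) : bool :=
  [&& W \subset V, W != set0,
      [forall eps in F, exists x in W, exists y in W,
          e x y && (eps == [set x; y])],
      #|F| == #|W| - 1 &
      [forall x in W, forall y in W,
          connect (fun a b => [set a; b] \in F) x y]].

Definition proper_edges (c : coloring) (F : {set {set T}}) : bool :=
  [forall eps1 in F, forall eps2 in F,
     (eps1 != eps2) && (eps1 :&: eps2 != set0) ==> (c eps1 != c eps2)].

(* c is a 3-proper coloring of G[V] using (at most) k colors: every edge of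
   G[V] gets a color < k, and every 3-subset S of V (every subset of V when
   |V| < 3, per the stated convention) lies in a proper S-tree of G[V]. *)
Definition three_proper_with (V : {set T}) (k : nat) (c : coloring) : bool :=
  [forall eps, is_edge V eps ==> (c eps < k)] &&
  [forall S : {set T}, (S \subset V) && (if 3 <= #|V| then #|S| == 3 else true)
     ==> [exists W : {set T}, exists F : {set {set T}},
            [&& is_subtree V W F, proper_edges c F & S \subset W]]].

Definition colorable3 (V : {set T}) (k : nat) : bool :=
  [exists c : coloring, three_proper_with V k c].

(* px_3(G[V]): the minimum k such that G[V] has a 3-proper coloring with k
   colors.  (For connected G[V] such a k <= palette exists.) *)
Definition px3 (V : {set T}) : nat :=
  \big[minn/palette]_(k < palette.+1 | colorable3 V k) k.

End Graphs.

(* The tightness example: complete graphs K_{i_1},...,K_{i_p} glued at one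
   common vertex v0.  Vertices: None = v0, Some (j, a) with a < i_j - 1 the
   other vertices of the j-th clique. *)
Definition glued_vertex (p : nat) (i : 'I_p -> nat) : finType :=
  option {j : 'I_p & 'I_(i j).-1}.

Definition glued_rel (p : nat) (i : 'I_p -> nat) : rel (glued_vertex i) :=
  fun x y => match x, y with
             | None, None => false
             | None, Some _ => true
             | Some _, None => true
             | Some u, Some v => (tag u == tag v) && (u != v)
             end.
Arguments glued_rel {p} i.

(* Main.v *)
Require Import Defs.
From mathcomp Require Import all_boot.
From mathcomp Require Import zify.
Set Implicit Arguments. Unset Strict Implicit. Unset Printing Implicit Defensive.

(** Give the vertices outside [D] levels so that each vertex of positive level
has a neighbour exactly one level below, with the sum of the levels as large as
possible.  With three new colors indexed modulo 3, an edge from a vertex of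
level [l] to [D] gets color [l], an edge between levels [l] and [l + 1] gets
color [l + 2], and any other edge outside [D] gets the color of its higher end;
further edges to [D] complete the colors a vertex may miss.  Moving at most two
levels up or down, every vertex outside [D] can then enter [D] through an edge
of any of the three colors.  Three vertices are joined by letting them enter [D]
along disjoint paths with distinct last colors, and linking the entry points by
a proper tree of [G[D]].  Maximality of the levels, together with minimum degree
3, settles the cases in which these paths would collide.

For the glued cliques, a tree containing vertices of three different cliques
has three edges at the common vertex, so two colors do not suffice. *)

(** * Maximal levelings *)

Section Levels.
Variables (T : finType) (e : rel T) (D : {set T}).
Hypotheses (e_sym : symmetric e) (e_irr : irreflexive e).

Definition outer_rel : rel T := fun x y => [&& x \notin D, y \notin D & e x y].

(** Adjacent vertices may differ by any amount; only one neighbour exactly one level below is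
    demanded, so a leveling can be modified locally. *)
Definition leveling (h : T -> nat) : Prop :=
  forall x, x \notin D -> 0 < h x -> exists2 y, outer_rel x y & (h y).+1 = h x.

Definition weight (h : T -> nat) : nat := \sum_(x | x \notin D) h x.

Definition max_leveling (h : T -> nat) : Prop :=
  leveling h /\ forall h', leveling h' -> weight h' <= weight h.

Definition upward (h : T -> nat) : rel T :=
  fun x y => outer_rel x y && (h y == (h x).+1).

Definition summit (h : T -> nat) (x : T) : bool := [forall y, ~~ upward h x y].

Lemma outer_sym : symmetric outer_rel.
Proof. by move=> x y; rewrite /outer_rel e_sym andbCA. Qed.

Lemma outer_neq x y : outer_rel x y -> x != y.
Proof. by case/and3P=> _ _; case: eqP => // ->; rewrite e_irr. Qed.

Lemma leveling_hits (h : T -> nat) x m :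
  leveling h -> x \notin D -> m <= h x -> exists2 y, y \notin D & h y = m.
Proof.
move=> hh; elim: (h x) {-2}x (erefl (h x)) => [|n IH] {}x hx xD mn.
  by exists x => //; lia.
have [->|neq] := eqVneq m n.+1; first by exists x.
have [|y /and3P[_ yD _] hy] := hh x xD; first by lia.
by apply: (IH y) => //; lia.
Qed.

(** The values from [0] to [h x] are all attained, so there are at least [h x + 1] vertices. This
    reduces the maximum over all levelings to a finite one. *)
Lemma leveling_bounded (h : T -> nat) x :
  leveling h -> x \notin D -> h x < #|T|.
Proof.
move=> hh xD; rewrite cardE -(size_map h) -(size_iota 0 (h x).+1).
apply: uniq_leq_size (iota_uniq _ _) _ => m; rewrite mem_iota => /andP[_ mx].
have [|y _ <-] := @leveling_hits h x m hh xD; first by lia.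
by rewrite map_f // mem_enum.
Qed.

Lemma max_leveling_exists : exists h, max_leveling h.
Proof.
pose lev (f : {ffun T -> 'I_#|T|.+1}) := fun x => f x : nat.
pose levb (f : {ffun T -> 'I_#|T|.+1}) := [forall x, (x \notin D) ==>
  (0 < f x) ==> [exists y, outer_rel x y && ((f y).+1 == f x)]].
have levP f : reflect (leveling (lev f)) (levb f).
  apply: (iffP forallP) => [H x xD x0|H x].
    have /implyP/(_ xD)/implyP/(_ x0)/existsP[y /andP[xy /eqP E]] := H x.
    by exists y.
  apply/implyP=> xD; apply/implyP=> x0; apply/existsP.
  by have [y xy E] := H x xD x0; exists y; rewrite xy; apply/eqP.
have lev0 : levb [ffun=> ord0] by apply/levP => x _; rewrite /lev ffunE.
pose f := [arg max_(f > [ffun=> ord0] | levb f) weight (lev f)].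
have [fl fmax] : levb f /\ forall g, levb g -> weight (lev g) <= weight (lev f).
  by rewrite /f; case: arg_maxnP.
exists (lev f); split; first exact/levP.
move=> h hh; pose g : {ffun T -> 'I_#|T|.+1} := [ffun x => inord (h x)].
have gE x : x \notin D -> lev g x = h x.
  by move=> xD; rewrite /lev ffunE inordK // ltnW // ltnS leveling_bounded.
have <- : weight (lev g) = weight h by apply: eq_bigr => x /gE.
apply: fmax; apply/levP => x xD; rewrite gE // => x0.
have [y xy E] := hh x xD x0; exists y => //.
by rewrite gE //; case/and3P: xy.
Qed.

Lemma weight_ltn (h h' : T -> nat) x :
  (forall y, y \notin D -> h y <= h' y) -> x \notin D -> h x < h' x ->
  weight h < weight h'.
Proof.
move=> le xD lt; rewrite /weight (bigD1 x) //= [X in _ < X](bigD1 x) //=.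
have := @leq_sum _ (index_enum T) (fun y => (y \notin D) && (y != x)) h h'.
have H : forall y, (y \notin D) && (y != x) -> h y <= h' y.
  by move=> y /andP[/le].
by move/(_ H); lia.
Qed.

(** * Local structure forced by maximality *)

Variable h : T -> nat.
Hypothesis h_max : max_leveling h.

Lemma no_better_leveling h' : leveling h' -> weight h < weight h' -> False.
Proof. by case: h_max => _ H /H; rewrite leqNgt => /negP. Qed.

Lemma summitPn x : reflect (exists y, upward h x y) (~~ summit h x).
Proof.
rewrite negb_forall; apply: (iffP existsP) => -[y H]; exists y => //.
  by rewrite negbK in H.
by rewrite negbK.
Qed.

Lemma down_neighbor x : x \notin D -> 0 < h x -> exists p, upward h p x.
Proof.
case: h_max => hh _ xD /(hh x xD)[p xp E].
by exists p; rewrite /upward outer_sym xp E eqxx.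
Qed.

Lemma upwardP x y :
  upward h x y -> [/\ outer_rel x y, h y = (h x).+1, x \notin D & y \notin D].
Proof. by case/andP=> xy /eqP E; case/and3P: (xy). Qed.

(** Otherwise [x] could be lifted to [h y + 1]: no vertex rests on a summit, so this is a leveling
    of larger weight. *)
Lemma summit_dominates x y : summit h x -> outer_rel x y -> h y < h x.
Proof.
move=> /forallP sx xy; rewrite ltnNge; apply/negP => le.
have [xD yD exy] := and3P xy.
pose h' z := if z == x then (h y).+1 else h z.
have nyx : (y == x) = false by rewrite eq_sym (negPf (outer_neq xy)).
apply: (@no_better_leveling h'); last first.
  apply: (@weight_ltn _ _ x); rewrite /h' ?eqxx // => z _; case: eqP => // ->.
  by lia.
move=> z zD; rewrite {1 3}/h'; case: (eqVneq z x) => [->|nzx] z0.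
  by exists y => //; rewrite /h' nyx.
have [hh _] := h_max; have [u zu E] := hh z zD z0; exists u => //.
rewrite /h'; case: eqP => // ux; have := sx z.
by rewrite /upward -ux outer_sym zu E eqxx.
Qed.

(** If [c] were the only vertex above [x], then [x] could be lifted to [h c + 1] and rest on [c],
    while [c] rests on [y] instead. *)
Lemma second_up_neighbor x y c :
  x != y -> upward h x c -> upward h y c -> exists2 c', upward h x c' & c' != c.
Proof.
move=> nxy xc yc; case: (pickP (fun c' => upward h x c' && (c' != c))).
  by move=> c' /andP[]; exists c'.
move=> none; exfalso; have only c' : upward h x c' -> c' = c.
  by move=> xc'; move: (none c'); rewrite xc' => /negbFE/eqP.
have [oxc hc xD cD] := upwardP xc; have [oyc hcy yD _] := upwardP yc.
have ncx : (c == x) = false by rewrite eq_sym (negPf (outer_neq oxc)).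
pose h' z := if z == x then (h c).+1 else h z.
apply: (@no_better_leveling h'); last first.
  apply: (@weight_ltn _ _ x); rewrite /h' ?eqxx ?hc //; try lia.
  by move=> z _; case: eqP => // ->; lia.
move=> z zD; rewrite {1 3}/h'; case: (eqVneq z x) => [->|nzx] z0.
  by exists c => //; rewrite /h' ncx.
have [hh _] := h_max; have [u zu E] := hh z zD z0.
have [ux|nux] := eqVneq u x; last by exists u => //; rewrite /h' (negPf nux).
have zc : z = c by apply: only; rewrite /upward -ux outer_sym zu E eqxx.
by exists y; rewrite zc 1?outer_sym // /h' eq_sym (negPf nxy) hcy.
Qed.

(* Otherwise rerooting at [x] raises everything above [r], in particular [r]
   and a second neighbour of [r] of level one, at the sole expense of [x]. *)
Lemma low_summit_reroot x r c :
  summit h x -> h x = 1 -> upward h r x -> upward h r c -> c = x.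
Proof.
move=> /forallP sx hx rx rc; apply/eqP/negPn/negP => ncx.
have [orx hxr rD xD] := upwardP rx; have [orc hcr _ cD] := upwardP rc.
have nrx := outer_neq orx; have nrc := outer_neq orc.
have hr : h r = 0 by lia.
pose B z := connect (upward h) r z.
have Br : B r by apply: connect0.
have Bc : B c by apply: connect1.
have Bup u z : B u -> upward h u z -> B z.
  by move=> Bu /connect1; apply: connect_trans.
have Bdown z : B z -> z != r -> exists2 u, B u & upward h u z.
  case/connectP => s; case/lastP: s => [_ /= ->|s w]; first by rewrite eqxx.
  rewrite rcons_path last_rcons => /andP[ps up] E _; rewrite -E in up.
  by exists (last r s) => //; apply/connectP; exists s.
clearbody B; pose h' z := if z == x then 0 else h z + B z.
have [hh _] := h_max; apply: (@no_better_leveling h').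
  move=> z zD; rewrite {1 3}/h'; case: (eqVneq z x) => // nzx.
  case: (eqVneq z r) => [->|nzr] z0.
    by exists x => //; rewrite /h' eqxx Br hr.
  have off u : upward h u z -> (u == x) = false.
    by move=> up; apply/eqP => ux; have := sx z; rewrite -ux up.
  (* [B] is closed upward, so a vertex outside [B] rests on a vertex outside [B], and neither level
     changes. *)
  case Bz: (B z) z0 => z0; last first.
    have [u zu E] : exists2 u, outer_rel z u & (h u).+1 = h z.
      by apply: hh => //; rewrite addn0 in z0.
    have up : upward h u z by rewrite /upward outer_sym zu E eqxx.
    have Bu : B u = false by apply/negP => Bu; rewrite (Bup _ _ Bu up) in Bz.
    by exists u => //; rewrite /h' off // Bu !addn0.
  have [u Bu up] := Bdown z Bz nzr; have [ouz E2 _ _] := upwardP up.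
  by exists u; rewrite 1?outer_sym // /h' off // Bu !addn1 E2.
pose P z := [&& z \notin D, z != x, z != r & z != c].
have split f : weight f = f x + (f r + (f c + \sum_(z | P z) f z)).
  rewrite /weight (bigD1 x) //= (bigD1 r) /=; last by rewrite rD.
  rewrite (bigD1 c) /=; last by rewrite cD ncx eq_sym.
  by do 3 congr (_ + _); apply: eq_bigl => z; rewrite /P -!andbA.
have le : \sum_(z | P z) h z <= \sum_(z | P z) h' z.
  by apply: leq_sum => z /and4P[_ nzx _ _]; rewrite /h' (negPf nzx) leq_addr.
rewrite !split; have -> : h' x = 0 by rewrite /h' eqxx.
have -> : h' r = (h r).+1 by rewrite /h' (negPf nrx) Br addn1.
have -> : h' c = (h c).+1 by rewrite /h' (negPf ncx) Bc addn1.
by rewrite hx add0n add1n [_.+1 + _]addSn ltnS ltn_add2l addSn ltnS leq_add2l.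
Qed.

(** Otherwise [r] could be put on top of [s], and [x] on top of [r]. No other vertex rested on [r],
    by the rerooting argument. *)
Lemma low_summit_root x r s :
  summit h x -> h x = 1 -> upward h r x -> outer_rel r s -> s = x.
Proof.
move=> sx hx rx rs; apply/eqP/negPn/negP => nsx.
have [orx hxr rD xD] := upwardP rx; have [_ sD _] := and3P rs.
have nrx := outer_neq orx; have nrs := outer_neq rs; have [hh _] := h_max.
pose h' z := if z == r then (h s).+1 else if z == x then (h s).+2 else h z.
apply: (@no_better_leveling h'); last first.
  apply: (@weight_ltn _ _ r); rewrite /h' ?eqxx //; try lia.
  by move=> z _; case: eqP => [->|_]; [lia|case: eqP => [->|_]; lia].
move=> z zD; rewrite {1 3}/h'; case: (eqVneq z r) => [->|nzr] z0.
  by exists s => //; rewrite /h' eq_sym (negPf nrs) (negPf nsx).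
move: z0; case: (eqVneq z x) => [->|nzx] z0.
  by exists r; rewrite 1?outer_sym // /h' eqxx.
have [u zu E] := hh z zD z0; exists u => //.
have up : upward h u z by rewrite /upward outer_sym zu E eqxx.
have nur : u != r.
  apply/eqP => ur; rewrite ur in up; move/eqP: nzx; apply.
  exact: low_summit_reroot up.
have nux : u != x by apply/eqP => ux; have /forallP/(_ z) := sx; rewrite -ux up.
by rewrite /h' (negPf nur) (negPf nux).
Qed.

(** A summit dominates its neighbours, so [s] has level 0 and lies below [x], as [r] does. Then [s]
    has a second upper neighbour, which rerooting at [x] excludes. *)
Lemma low_summit_unique_neighbor x r s :
  summit h x -> h x = 1 -> upward h r x -> outer_rel x s -> s = r.
Proof.
move=> sx hx rx xs; apply/eqP/negPn/negP => nsr.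
have hs := summit_dominates sx xs.
have ux : upward h s x by rewrite /upward outer_sym xs /= hx; apply/eqP; lia.
have [c sc ncx] := second_up_neighbor nsr ux rx.
by rewrite (low_summit_reroot sx hx ux sc) eqxx in ncx.
Qed.

End Levels.

(** * Growing proper trees *)

Section ProperTrees.
Variables (T : finType) (e : rel T) (c : coloring T).

Definition proper_tree (W : {set T}) (F : {set {set T}}) : bool :=
  is_subtree e [set: T] W F && proper_edges c F.

Lemma proper_tree_edge W F f :
  proper_tree W F -> f \in F -> exists x y, [/\ x \in W, y \in W, e x y & f = [set x; y]].
Proof.
case/andP=> /and5P[_ _ /forall_inP H _ _] _ /H.
by case/exists_inP=> x xW /exists_inP[y yW /andP[exy /eqP ->]]; exists x, y.
Qed.

Lemma proper_tree_edge_sub W F f : proper_tree W F -> f \in F -> f \subset W.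
Proof.
move=> t /(proper_tree_edge t)[x [y [xW yW _ ->]]].
by apply/subsetP => z; rewrite !inE => /orP[] /eqP ->.
Qed.

(** A new leaf raises the vertex and edge counts by one each and keeps connectedness; its edge meets
    only the tree edges at [u]. *)
Lemma attach_edge W F u v :
  proper_tree W F -> u \in W -> v \notin W -> e u v ->
  (forall f, f \in F -> u \in f -> c f != c [set u; v]) ->
  proper_tree (v |: W) ([set u; v] |: F).
Proof.
move=> t uW vW euv cF; have sub := proper_tree_edge_sub t.
have vF f : f \in F -> v \in f = false.
  by move/sub/subsetP => fW; apply/negP => /fW; apply/negP.
case/andP: t => /and5P[_ W0 /forall_inP HF /eqP cardF /forall_inP conn].
move=> /forall_inP prop.
have FN : [set u; v] \notin F by apply/negP => /vF; rewrite !inE eqxx orbT.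
have relS : subrel (connect (fun a b => [set a; b] \in F))
                   (connect (fun a b => [set a; b] \in [set u; v] |: F)).
  by apply: connect_sub => a b ab; apply: connect1; rewrite inE ab orbT.
apply/andP; split; first apply/and5P; first split.
- exact: subsetT.
- by apply/set0Pn; exists u; rewrite inE uW orbT.
- apply/forall_inP => f; rewrite !inE => /orP[/eqP ->|/HF].
    apply/exists_inP; exists u; first by rewrite inE uW orbT.
    by apply/exists_inP; exists v; [rewrite inE inE eqxx|rewrite euv eqxx].
  case/exists_inP => x xW /exists_inP[y yW H].
  apply/exists_inP; exists x; first by rewrite inE xW orbT.
  by apply/exists_inP; exists y => //; rewrite inE yW orbT.
- rewrite !cardsU1 FN vW cardF.
  by rewrite -card_gt0 in W0; lia.
- have symF a b : ([set a; b] \in [set u; v] |: F) = ([set b; a] \in [set u; v] |: F).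
    by rewrite (setUC [set a]).
  have toU x : x \in v |: W ->
      connect (fun a b => [set a; b] \in [set u; v] |: F) x u.
    rewrite !inE => /orP[/eqP ->|xW].
      by apply: connect1; rewrite symF !inE eqxx.
    by apply: relS; have /forall_inP := conn x xW; apply.
  apply/forall_inP => x /toU xu; apply/forall_inP => y /toU yu.
  by apply: connect_trans xu _; rewrite (sym_connect_sym symF).
- have new f : f \in F -> f :&: [set u; v] != set0 -> c f != c [set u; v].
    move=> fF /set0Pn[z]; rewrite !inE => /andP[zf /orP[]/eqP E]; subst z.
      exact: cF.
    by rewrite vF in zf.
  apply/forall_inP => f; rewrite !inE => fF; apply/forall_inP => g; rewrite !inE => gF.
  apply/implyP => /andP[nfg meet].
  case/orP: fF nfg meet => [/eqP->|fF]; case/orP: gF => [/eqP->|gF].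
  + by rewrite eqxx.
  + by move=> _ m; rewrite eq_sym; apply: new; rewrite // setIC.
  + by move=> _; apply: new.
  + move=> n m; have /forall_inP/(_ g gF)/implyP := prop f fF.
    by apply; rewrite n.
Qed.

Fixpoint alternates (u v : T) (s : seq T) : bool :=
  if s is w :: s' then (c [set u; v] != c [set v; w]) && alternates v w s' else true.

(** The description of the new edges permits repeated use: all but the first one stay inside the
    attached path. *)
Lemma attach_path W F u v s :
  proper_tree W F -> u \in W ->
  (forall f, f \in F -> u \in f -> c f != c [set u; v]) ->
  path e u (v :: s) -> uniq (v :: s) -> {in v :: s, forall x, x \notin W} ->
  alternates u v s ->
  exists2 F', proper_tree (W :|: [set x in v :: s]) F' &
    forall f, f \in F' -> [\/ f \in F, f = [set u; v] | {subset f <= v :: s}].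
Proof.
elim: s u v W F => [|w s IH] u v W F t uW cF /=.
  rewrite andbT => euv _ sW _; exists ([set u; v] |: F).
    have -> : W :|: [set x in [:: v]] = v |: W.
      by apply/setP => x; rewrite !inE orbC.
    by apply: attach_edge => //; apply: sW; rewrite inE.
  by move=> f; rewrite !inE => /orP[/eqP->|]; [constructor 2|constructor 1].
case/andP=> euv pvw /andP[vs us] sW /andP[alt1 alt2].
have vW : v \notin W by apply: sW; rewrite inE eqxx.
have t1 := attach_edge t uW vW euv cF.
have [||||||F' t' HF'] := IH v w (v |: W) _ t1 => //.
- by rewrite !inE eqxx.
- move=> f; rewrite !inE => /orP[/eqP-> //|fF] vf.
  by have /subsetP/(_ v vf) := proper_tree_edge_sub t fF; rewrite (negPf vW).
- move=> x xs; rewrite !inE negb_or; apply/andP; split.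
    by apply: contraNN vs => /eqP <-.
  by apply: sW; rewrite inE xs orbT.
exists F'.
  have -> : W :|: [set x in [:: v, w & s]] = (v |: W) :|: [set x in w :: s] => //.
  by apply/setP => x; rewrite !inE; case: (x == v); rewrite /= ?orbT.
move=> f /HF'[|->|fs].
- by rewrite !inE => /orP[/eqP->|]; [constructor 2|constructor 1].
- by constructor 3 => x; rewrite !inE => /orP[] ->; rewrite ?orbT.
- by constructor 3 => x /fs xs; rewrite inE xs orbT.
Qed.

Variable D : {set T}.

(* A branch [(u, v, s)] is the path [u, v, s] that starts in [D] and never
   returns to it. *)
Definition branch (b : T * T * seq T) : bool :=
  [&& b.1.1 \in D, all (fun x => x \notin D) (b.1.2 :: b.2), uniq (b.1.2 :: b.2),
      path e b.1.1 (b.1.2 :: b.2) & alternates b.1.1 b.1.2 b.2].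

Definition branch_verts (b : T * T * seq T) : seq T := b.1.2 :: b.2.

Definition branch_color (b : T * T * seq T) := c [set b.1.1; b.1.2].

(** A branch meets [D] only in its first edge, so distinct first colors prevent conflicts even when
    several branches start at the same vertex. *)
Lemma attach_branches (bs : seq (T * T * seq T)) W F :
  proper_tree W F -> all branch bs -> {in bs, forall b, b.1.1 \in W} ->
  uniq (map branch_color bs) -> uniq (flatten (map branch_verts bs)) ->
  {in flatten (map branch_verts bs), forall x, x \notin W} ->
  (forall f u, f \in F -> u \in D -> u \in f -> c f \notin map branch_color bs) ->
  exists W' F', [/\ proper_tree W' F', W \subset W' &
                    {subset flatten (map branch_verts bs) <= W'}].
Proof.
elim: bs W F => [|[[u v] s] bs IH] W F t; first by exists W, F; split.
move=> /= /andP[/and5P/=[uD sD us ps alts] brs] feet /andP[ncol ucol].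
rewrite -[_ :: s ++ _]/((v :: s) ++ flatten (map branch_verts bs)).
rewrite -[_ && uniq _]/(uniq ((v :: s) ++ flatten (map branch_verts bs))).
rewrite cat_uniq => /and3P[_ disj ufl] offW cF.
have [||||||F1 t1 HF1] := @attach_path W F u v s t => //.
- exact: (feet _ (mem_head _ _)).
- move=> f fF uf; have := cF f u fF uD uf; rewrite inE negb_or => /andP[H _].
  exact: H.
- by move=> x xs; apply: offW; rewrite mem_cat xs.
have [|||W' [F' [t' sub all']]] := IH _ _ t1 brs _ ucol ufl.
- by move=> b bb; rewrite inE feet // inE bb orbT.
- move=> x xfl; rewrite !inE negb_or; apply/andP; split.
    by apply: offW; rewrite mem_cat xfl orbT.
  by apply: contraNN disj => xs; apply/hasP; exists x => //; rewrite /= inE.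
- move=> f w /HF1[fF|->|fs] wD wf.
  + by have := cF f w fF wD wf; rewrite inE negb_or => /andP[].
  + exact: ncol.
  + have /allP off : all (fun x => x \notin D) (v :: s) by [].
    by have := off w (fs w wf); rewrite wD.
exists W', F'; split=> //; first exact: subset_trans (subsetUl _ _) sub.
move=> x; rewrite mem_cat => /orP[xs|/all' //].
by apply: (subsetP sub); rewrite inE [X in _ || X]inE xs orbT.
Qed.

End ProperTrees.

(** * The extended coloring *)

Lemma set2_eq (T : finType) (x y a b : T) :
  [set x; y] = [set a; b] -> x = a /\ y = b \/ x = b /\ y = a.
Proof.
move=> E; have := set21 x y; have := set22 x y; have := set21 a b; have := set22 a b.
by rewrite {1 2}E -{1 2}E => /set2P[] ? /set2P[] ? /set2P[] ? /set2P[] ?; subst; auto.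
Qed.

Lemma superset_of_card (T : finType) (X D : {set T}) n :
  X \subset D -> #|X| <= n <= #|D| ->
  exists S : {set T}, [/\ X \subset S, S \subset D & #|S| = n].
Proof.
move Em: (n - #|X|) => m; elim: m X Em => [|m IH] X Em XD /andP[Xn nD].
  by exists X; split=> //; lia.
have /set0Pn[x] : D :\: X != set0 by rewrite -card_gt0 cardsDS //; lia.
rewrite inE => /andP[xX xD].
have [|||S [XS SD cS]] := IH (x |: X); rewrite ?cardsU1 ?xX ?subUset ?sub1set ?xD //; try lia.
by exists S; split=> //; move: XS; rewrite subUset => /andP[].
Qed.

(** If [V] has at least three vertices, [X] is first enlarged to a 3-set; otherwise the convention
    covers every subset. *)
Lemma three_proper_small (T : finType) (e : rel T) (V : {set T}) k c (X : {set T}) :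
  three_proper_with e V k c -> X \subset V -> #|X| <= 3 ->
  exists W F, [/\ is_subtree e V W F, proper_edges c F & X \subset W].
Proof.
case/andP=> _ /forallP H XV X3.
have [S [XS SV cS]] : exists S : {set T}, [/\ X \subset S, S \subset V &
    if 3 <= #|V| then #|S| == 3 else true].
  case V3: (3 <= #|V|); last by exists X.
  have [|S [XS SV cS]] := @superset_of_card T X V 3 XV; first by rewrite X3.
  by exists S; rewrite XS SV cS.
have := H S; rewrite SV cS => /existsP[W /existsP[F /and3P[WF pF SW]]].
by exists W, F; split=> //; apply: subset_trans SW.
Qed.

Section ExtendedColoring.
Variables (T : finType) (e : rel T) (D : {set T}) (h : T -> nat).
Variables (k : nat) (c0 : coloring T).
Hypotheses (e_sym : symmetric e) (e_irr : irreflexive e).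
Hypothesis palette_big : k + 3 <= palette T.

Definition legs (x : T) : seq T := enum [set u in D | e x u].

(** The first leg carries the level. A summit has no upper neighbour to provide the color [h x + 1],
    so its second leg does; elsewhere the second leg provides [h x + 2], which a vertex of level 0
    may miss. *)
Definition leg_color (x u : T) : nat :=
  (h x + match index u (legs x) with
         | 0 => 0
         | 1 => if summit e D h x then 1 else 2
         | _ => if summit e D h x then 2 else 1
         end) %% 3.

(** Between consecutive levels the color differs from both levels modulo 3, so the edge can follow
    the first leg of either end. *)
Definition outer_color (x y : T) : nat :=
  (if h y == (h x).+1 then h x + 2 else
   if h x == (h y).+1 then h y + 2 else maxn (h x) (h y)) %% 3.

Definition ext_color (x y : T) : nat :=
  if x \in D then if y \in D then (c0 [set x; y] : nat) else k + leg_color y x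
  else if y \in D then k + leg_color x y else k + outer_color x y.

(** Colors belong to sets, so an ordered representation of the pair is picked; the symmetry of
    [ext_color] makes the choice immaterial. By [palette_big] the default of [insubd] is never taken
    on a pair. *)
Definition ext_coloring : coloring T :=
  [ffun f => if [pick xy : T * T | f == [set xy.1; xy.2]] is Some xy
             then insubd (c0 f) (ext_color xy.1 xy.2) else c0 f].

Lemma outer_colorC x y : outer_color x y = outer_color y x.
Proof. by rewrite /outer_color; do 2 case: eqP => //; lia. Qed.

Lemma ext_colorC x y : ext_color x y = ext_color y x.
Proof.
by rewrite /ext_color setUC outer_colorC; case: (x \in D); case: (y \in D).
Qed.

Lemma ext_color_palette x y : ext_color x y < palette T.
Proof.
have lt3 m : k + m %% 3 < palette T.
  by apply: leq_trans palette_big; rewrite ltn_add2l ltn_mod.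
by rewrite /ext_color; case: ifP => _; case: ifP => _; [apply: ltn_ord|apply: lt3..].
Qed.

Lemma ext_coloringE x y : ext_coloring [set x; y] = ext_color x y :> nat.
Proof.
rewrite ffunE; case: pickP => [[a b] /= /eqP E|/(_ (x, y))]; last by rewrite eqxx.
rewrite val_insubd ext_color_palette.
by case: (set2_eq E) => -[-> ->] //; apply: ext_colorC.
Qed.

Hypotheses (dom : dominating e D) (deg : forall v, v \notin D -> 3 <= #|[set u | e v u]|).
Hypothesis h_max : max_leveling e D h.

(** * Entering [D] in a prescribed new color *)

Local Notation outer := (outer_rel e D).
Local Notation up := (upward e D h).
Local Notation peak := (summit e D h).
Local Notation branch' := (branch e ext_coloring D).

(** The path is read from [D] outward: [v] is next to [D], and [s] leads on, usually to the vertex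
    that is to be covered. *)
Definition escape (v : T) (s : seq T) (j : nat) : Prop :=
  exists2 u, branch' (u, v, s) & ext_coloring [set u; v] = k + j %% 3 :> nat.

Lemma legsP x u : (u \in legs x) = (u \in D) && e x u.
Proof. by rewrite mem_enum inE. Qed.

Lemma leg_exists x r : r < size (legs x) ->
  exists u, [/\ u \in D, e u x & index u (legs x) = r].
Proof.
move=> rx; case E : (legs x) (rx) => [//|u0 s] _; rewrite -E.
exists (nth u0 (legs x) r); have := mem_nth u0 rx; rewrite legsP => /andP[-> xu].
by rewrite e_sym xu index_uniq // enum_uniq.
Qed.

Lemma escape_leg x r : x \notin D -> r < size (legs x) ->
  escape x [::] (h x + match r with
                       | 0 => 0
                       | 1 => if peak x then 1 else 2
                       | _ => if peak x then 2 else 1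
                       end).
Proof.
move=> xD /leg_exists[u [uD eux ix]]; exists u.
  by rewrite /branch /= uD xD eux.
by rewrite ext_coloringE /ext_color uD (negPf xD) /leg_color ix.
Qed.

Lemma legs_gt0 x : x \notin D -> 0 < size (legs x).
Proof.
case/dom=> u uD xu; have : u \in legs x by rewrite legsP uD.
by case: (legs x).
Qed.

Lemma escape_direct x : x \notin D -> escape x [::] (h x).
Proof. by move=> xD; have := escape_leg xD (legs_gt0 xD); rewrite addn0. Qed.

Lemma escape_edge v w :
  outer v w -> h v %% 3 != outer_color v w -> escape v [:: w] (h v).
Proof.
move=> vw neq; have [vD wD evw] := and3P vw; have nvw := outer_neq e_irr vw.
have [u /and5P[/= uD _ _ /andP[euv _] _] cu] := escape_direct vD; exists u => //.
rewrite /branch /= uD vD wD inE nvw euv evw /= andbT.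
rewrite -val_eqE /= cu ext_coloringE /ext_color (negPf vD) (negPf wD).
by rewrite eqn_add2l.
Qed.

Lemma escape_edge2 v w x :
  outer v w -> outer w x -> v != x -> h v %% 3 != outer_color v w ->
  outer_color v w != outer_color w x -> escape v [:: w; x] (h v).
Proof.
move=> vw wx nvx n1 n2; have [vD wD evw] := and3P vw; have [_ xD ewx] := and3P wx.
have nvw := outer_neq e_irr vw; have nwx := outer_neq e_irr wx.
have [u /and5P[/= uD _ _ /andP[euv _] _] cu] := escape_direct vD; exists u => //.
rewrite /branch /= uD vD wD xD !inE negb_or nvw nvx nwx euv evw ewx /= andbT.
rewrite -!val_eqE /= cu !ext_coloringE /ext_color (negPf vD) (negPf wD) (negPf xD).
by rewrite !eqn_add2l n1.
Qed.

Lemma upward_color p x : up p x -> outer_color p x = (h p + 2) %% 3.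
Proof. by case/upwardP=> _ hx _ _; rewrite /outer_color hx eqxx. Qed.

(** Here and in the next three lemmas [x] reaches [D] through one or two lower or upper neighbours.
    From level [l] the entry colors are [l - 1], [l + 1], [l - 2] and [l + 2], so modulo 3 two steps
    one way replace one step the other way. *)
Lemma escape_up p x : up p x -> escape p [:: x] (h p).
Proof.
move=> px; have [opx _ _ _] := upwardP px; apply: escape_edge => //.
by rewrite upward_color //; lia.
Qed.

Lemma escape_down x c : up x c -> escape c [:: x] (h c).
Proof.
move=> xc; have [oxc hc _ _] := upwardP xc.
apply: escape_edge; first by rewrite (outer_sym _ e_sym).
by rewrite outer_colorC upward_color //; lia.
Qed.

Lemma escape_up2 g p x : up g p -> up p x -> escape g [:: p; x] (h g).
Proof.
move=> gp px; have [ogp hp _ _] := upwardP gp; have [opx hx _ _] := upwardP px.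
apply: escape_edge2 => //; rewrite ?upward_color //; try lia.
by apply/eqP => E; rewrite -E in hx; lia.
Qed.

Lemma escape_down2 x c g : up x c -> up c g -> escape g [:: c; x] (h g).
Proof.
move=> xc cg; have [oxc hc _ _] := upwardP xc; have [ocg hg _ _] := upwardP cg.
apply: escape_edge2; rewrite 1?(outer_sym _ e_sym) //.
- by apply/eqP => E; rewrite -E in hc; lia.
- by rewrite outer_colorC upward_color //; lia.
- by rewrite outer_colorC upward_color // outer_colorC upward_color //; lia.
Qed.

(** Minimum degree 3 turns a shortage of neighbours outside [D] into a supply of legs. *)
Lemma degree_split x (A : seq T) : x \notin D ->
  (forall y, outer x y -> y \in A) -> 3 <= size (legs x) + size A.
Proof.
move=> xD H; apply: leq_trans (deg xD) _; rewrite -size_cat cardE.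
apply: uniq_leq_size (enum_uniq _) _ => y; rewrite mem_enum inE mem_cat legsP => xy.
case yD: (y \in D); first by rewrite xy.
by rewrite H ?orbT // /outer_rel xD yD.
Qed.

(** If [c] is a summit, it has level 1 and is the only neighbour of [y] outside [D]. So [y] has a
    second leg, colored [h y + 2] because [y] is no summit. *)
Lemma root_escape y c : h y = 0 -> up y c ->
  escape y [::] (h y + 2) \/ exists g, up c g.
Proof.
move=> hy yc; have [oyc hc yD cD] := upwardP yc.
case sc: (peak c); last by right; apply/summitPn; rewrite sc.
left; have legs2 : 3 <= size (legs y) + 1.
  by apply: (@degree_split y [:: c]) => // s ys; rewrite inE;
    rewrite (low_summit_root _ _ h_max sc _ yc ys) //; lia.
have := @escape_leg y 1 yD; case: ifP => [sy|_ H].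
  by move/forallP/(_ c): sy; rewrite yc.
by apply: H; lia.
Qed.

(** Neighbours outside [D] would lie strictly below level 0, so [y] has three legs, which show all
    new colors. *)
Lemma root_summit_escape y : y \notin D -> h y = 0 -> peak y ->
  escape y [::] (h y + 1) /\ escape y [::] (h y + 2).
Proof.
move=> yD hy sy; have l3 : 3 <= size (legs y) + 0.
  by apply: (@degree_split y [::]) => // s /(summit_dominates e_sym e_irr h_max sy); rewrite hy.
have := @escape_leg y 1 yD; have := @escape_leg y 2 yD.
by rewrite sy => H2 H1; split; [apply: H1|apply: H2]; lia.
Qed.

(** If [p] has level 0, it is the only neighbour of [y] outside [D], and the second leg of [y] has
    the color [h y + 1]. *)
Lemma summit_escape y p : peak y -> up p y ->
  escape y [::] (h y + 1) \/ exists g, up g p.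
Proof.
move=> sy py; have [opy hy pD yD] := upwardP py.
have [hp|hp] := posnP (h p); last by right; apply: (down_neighbor e_sym h_max).
left; have legs2 : 3 <= size (legs y) + 1.
  apply: (@degree_split y [:: p]) => // s ys; rewrite inE.
  by rewrite (low_summit_unique_neighbor _ _ h_max sy _ py ys) //; lia.
by have := @escape_leg y 1 yD; rewrite sy; apply; lia.
Qed.

(** With no more branches than vertices of [A], the entry points can replace [A] in a set of at most
    three vertices. First colors from [k] on cannot clash with those used in [D]. One branch may
    cover several vertices. *)
Definition cover (A : seq T) : Prop :=
  exists bs : seq (T * T * seq T),
    [/\ size bs <= size A, all branch' bs,
        uniq (map (branch_color ext_coloring) bs)
          /\ {in bs, forall b, k <= branch_color ext_coloring b},
        uniq (flatten (map (@branch_verts T) bs)) &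
        {subset A <= flatten (map (@branch_verts T) bs)}].

Lemma cover_sub A B : size A = size B -> {subset B <= A} -> cover A -> cover B.
Proof.
move=> sz sub [bs [le br col un AS]]; exists bs; split=> //; first by rewrite -sz.
by move=> x /sub /AS.
Qed.

Lemma cover_escapes (es : seq (T * seq T * nat)) A :
  (forall b, b \in es -> escape b.1.1 b.1.2 b.2) -> size es <= size A ->
  uniq (map (fun b => b.2 %% 3) es) ->
  uniq (flatten (map (fun b => b.1.1 :: b.1.2) es)) ->
  {subset A <= flatten (map (fun b => b.1.1 :: b.1.2) es)} ->
  cover A.
Proof.
move=> esc sz ucol; set verts := map _ es; move=> uv sub.
suff [bs [szb br colE vE]] : exists bs : seq (T * T * seq T),
    [/\ size bs = size es, all branch' bs,
        map (fun b => branch_color ext_coloring b : nat) bs = map (fun b => k + b.2 %% 3) es &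
        map (@branch_verts T) bs = verts].
  exists bs; rewrite vE szb; split=> //; split.
    rewrite -(map_inj_uniq val_inj) -map_comp.
    rewrite (eq_map (g := fun b => branch_color ext_coloring b : nat)) // colE.
    rewrite (eq_map (g := addn k \o (fun b => b.2 %% 3))) // map_comp.
    by rewrite (map_inj_uniq (@addnI k)).
  move=> b bb; have : (branch_color ext_coloring b : nat) \in
      map (fun b => branch_color ext_coloring b : nat) bs by exact: map_f.
  by rewrite colE => /mapP[? _ ->]; apply: leq_addr.
rewrite /verts; clear -esc; elim: es esc => [|[[v s] j] es IH] esc.
  by exists [::].
have [|bs [szb br colE vE]] := IH; first by move=> b bb; apply: esc; rewrite inE bb orbT.
have [u bu cu] := esc _ (mem_head _ _).
by exists ((u, v, s) :: bs); rewrite /= szb colE vE bu br /branch_color /= cu.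
Qed.

Ltac level_arith :=
  repeat match goal with
  | H : escape _ _ _ |- _ => clear H
  | H : is_true (_ \notin _) |- _ => clear H
  | H : is_true (upward _ _ _ _ _) |- _ => clear H
  | H : is_true (outer_rel _ _ _ _) |- _ => clear H
  | H : is_true (summit _ _ _ _) |- _ => clear H
  | H : is_true (@negb (@eq_op (Finite.sort _) _ _)) |- _ => clear H
  end; clear palette_big; lia.

(** Vertices not known to be distinct are told apart by their levels, mostly modulo 3. *)
Ltac differ :=
  match goal with
  | H : is_true ?b |- is_true ?b => exact: H
  | H : is_true (?x != ?y) |- is_true (?y != ?x) => by rewrite eq_sym
  | _ => let E := fresh in apply/eqP => E; apply (f_equal h) in E; level_arith
  end.

Ltac distinct := rewrite /= ?inE ?negb_or ?andbT; repeat (apply/andP; split); try done; try differ.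

Ltac by_escapes es :=
  apply: (@cover_escapes es);
  [ let b := fresh in move=> b; rewrite !inE; (repeat case/orP); move/eqP=> -> /=; try eassumption
  | by []
  | distinct; apply/eqP; level_arith
  | distinct
  | let a := fresh in move=> a; rewrite /= !inE; (repeat case/orP); move=> ->; rewrite ?orbT; done ].

Ltac permute A :=
  apply: (@cover_sub A) => //; first by move=> u; rewrite !inE; do 3 case: eqP.

(** * Covering up to three vertices outside [D] *)

Lemma cover1 x : x \notin D -> cover [:: x].
Proof.
move=> xD; have ex := escape_direct xD.
by_escapes [:: (x, [::] : seq T, h x)].
Qed.

(** In each case [y] reaches [D] in the color [h y - 1] modulo 3: through a lower neighbour, by a
    leg, or by climbing two levels. Dually, [escape_plus] provides [h y + 1]. *)
Lemma escape_minus y : y \notin D ->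
  [\/ exists p, up p y, escape y [::] (h y + 2) |
      exists c g, [/\ h y = 0, up y c & up c g]].
Proof.
move=> yD; have [hy|hy] := posnP (h y); last first.
  by constructor 1; apply: (down_neighbor e_sym h_max).
have [sy|/summitPn[c yc]] := boolP (peak y).
  by constructor 2; apply: (root_summit_escape yD hy sy).2.
by case: (root_escape hy yc) => [|[g cg]]; [constructor 2|constructor 3; exists c, g].
Qed.

Lemma escape_plus y : y \notin D ->
  [\/ exists c, up y c, escape y [::] (h y + 1) |
      exists p g, up p y /\ up g p].
Proof.
move=> yD; have [sy|/summitPn[c yc]] := boolP (peak y); last by constructor 1; exists c.
have [hy|hy] := posnP (h y).
  by constructor 2; apply: (root_summit_escape yD hy sy).1.
have [p py] := down_neighbor e_sym h_max yD hy.
by case: (summit_escape sy py) => [|[g gp]]; [constructor 2|constructor 3; exists p, g].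
Qed.

(** If the residues agree, [y] makes a detour, whose other vertices have residues different from
    that of [x]. *)
Lemma cover2 x y : x \notin D -> y \notin D -> x != y -> cover [:: x; y].
Proof.
move=> xD yD nxy; have ex := escape_direct xD; have ey := escape_direct yD.
have [E|NE] := eqVneq (h x %% 3) (h y %% 3); last first.
  by_escapes [:: (x, [::] : seq T, h x); (y, [::], h y)].
case: (escape_minus yD) => [[p py]|ey2|[c [g [hy yc cg]]]].
- have ep := escape_up py; have [_ hp _ _] := upwardP py.
  by_escapes [:: (x, [::] : seq T, h x); (p, [:: y], h p)].
- by_escapes [:: (x, [::] : seq T, h x); (y, [::], h y + 2)].
- have eg := escape_down2 yc cg; have [_ hc _ _] := upwardP yc; have [_ hg _ _] := upwardP cg.
  by_escapes [:: (x, [::] : seq T, h x); (g, [:: c; y], h g)].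
Qed.

(** [x] and [z] enter directly and [y] takes the remaining color. Its detour can only collide with
    [z], and then the path through [z] to [y] covers both. *)
Lemma cover3_two_classes x y z :
  x \notin D -> y \notin D -> z \notin D -> x != y ->
  h x %% 3 = h y %% 3 -> h z %% 3 != h y %% 3 -> cover [:: x; y; z].
Proof.
move=> xD yD zD nxy xy zy; have ex := escape_direct xD; have ez := escape_direct zD.
have [zm|zm] : h z %% 3 = (h y + 2) %% 3 \/ h z %% 3 = (h y + 1) %% 3 by lia.
  case: (escape_plus yD) => [[c yc]|ey|[p [g [py gp]]]].
  - have ec := escape_down yc; have [_ hc _ _] := upwardP yc.
    by_escapes [:: (x, [::] : seq T, h x); (z, [::], h z); (c, [:: y], h c)].
  - by_escapes [:: (x, [::] : seq T, h x); (z, [::], h z); (y, [::], h y + 1)].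
  - have [_ hy _ _] := upwardP py; have [_ hp _ _] := upwardP gp.
    have [E|npz] := eqVneq p z.
      have ep := escape_up py; subst p.
      by_escapes [:: (x, [::] : seq T, h x); (z, [:: y], h z)].
    have eg := escape_up2 gp py.
    by_escapes [:: (x, [::] : seq T, h x); (z, [::], h z); (g, [:: p; y], h g)].
case: (escape_minus yD) => [[p py]|ey|[c [g [hy yc cg]]]].
- have ep := escape_up py; have [_ hp _ _] := upwardP py.
  by_escapes [:: (x, [::] : seq T, h x); (z, [::], h z); (p, [:: y], h p)].
- by_escapes [:: (x, [::] : seq T, h x); (z, [::], h z); (y, [::], h y + 2)].
- have [_ hc _ _] := upwardP yc; have [_ hg _ _] := upwardP cg.
  have [E|ncz] := eqVneq c z.
    have ec := escape_down yc; subst c.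
    by_escapes [:: (x, [::] : seq T, h x); (z, [:: y], h z)].
  have eg := escape_down2 yc cg.
  by_escapes [:: (x, [::] : seq T, h x); (z, [::], h z); (g, [:: c; y], h g)].
Qed.

(** [d] enters directly, [b] through a lower neighbour and [a] through an upper one, in three
    different colors. *)
Lemma cover3_up_down a b d :
  d \notin D -> a != b -> a != d -> b != d ->
  h a %% 3 = h b %% 3 -> h d %% 3 = h b %% 3 ->
  ~~ peak a -> b \notin D -> 0 < h b -> cover [:: a; b; d].
Proof.
move=> dD nab nad nbd ab db /summitPn[c ac] bD hb.
have [p pb] := down_neighbor e_sym h_max bD hb.
have ed := escape_direct dD; have ep := escape_up pb; have ec := escape_down ac.
have [_ hc _ _] := upwardP ac; have [_ hp _ _] := upwardP pb.
by_escapes [:: (d, [::] : seq T, h d); (p, [:: b], h p); (c, [:: a], h c)].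
Qed.

Lemma cover3_summit_leg a b d :
  a \notin D -> b \notin D -> d \notin D -> a != b -> a != d -> b != d ->
  h a %% 3 = h b %% 3 -> h d %% 3 = h b %% 3 ->
  peak b -> escape a [::] (h a + 1) -> cover [:: a; b; d].
Proof.
move=> aD bD dD nab nad nbd ab db sb ea; have ed := escape_direct dD.
have [hb|hb] := posnP (h b).
  have [_ eb] := root_summit_escape bD hb sb.
  by_escapes [:: (d, [::] : seq T, h d); (b, [::], h b + 2); (a, [::], h a + 1)].
have [p pb] := down_neighbor e_sym h_max bD hb.
have ep := escape_up pb; have [_ hp _ _] := upwardP pb.
by_escapes [:: (d, [::] : seq T, h d); (p, [:: b], h p); (a, [::], h a + 1)].
Qed.

(** [a] descends one level and [b] two; by residues, [p = q] is the only collision to exclude. *)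
Lemma cover3_distinct_parents a b d p q g :
  d \notin D -> a != b -> a != d -> b != d ->
  h a %% 3 = h b %% 3 -> h d %% 3 = h b %% 3 ->
  up p a -> up q b -> up g q -> p != q -> cover [:: a; b; d].
Proof.
move=> dD nab nad nbd ab db pa qb gq npq; have ed := escape_direct dD.
have ep := escape_up pa; have eg := escape_up2 gq qb.
have [_ hp _ _] := upwardP pa; have [_ hq _ _] := upwardP qb; have [_ hg _ _] := upwardP gq.
by_escapes [:: (d, [::] : seq T, h d); (p, [:: a], h p); (g, [:: q; b], h g)].
Qed.

(* The third neighbour [w] of [a] resolves the conflict: it is not a summit
   since [a] lies above it, and [aw] has the color of the level of [a]. *)
Lemma cover3_common_parent a b d p g :
  a != b -> a != d -> b != d -> peak a ->
  up p a -> up p b -> up p d -> up g p ->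
  escape a [::] (h a + 1) \/ cover [:: a; b; d].
Proof.
move=> nab nad nbd sa pa pb pd gp.
have [_ ha pD aD] := upwardP pa; have [_ hb _ _] := upwardP pb.
have [_ hd _ dD] := upwardP pd; have [_ hp _ _] := upwardP gp.
have [l2|l2] := leqP 2 (size (legs a)).
  by left; have := escape_leg aD l2; rewrite sa.
right; case: (pickP (fun w => outer a w && (w != p))) => [w /andP[aw nwp]|none].
  have lt := summit_dominates e_sym e_irr h_max sa aw.
  have sw : ~~ peak w.
    apply/negP => sw; have := summit_dominates e_sym e_irr h_max sw (y := a).
    by rewrite (outer_sym _ e_sym) => /(_ aw)/(ltn_trans lt); rewrite ltnn.
  have [E|NE] := eqVneq (h w).+1 (h a).
    apply: (@cover3_distinct_parents _ _ _ w p g) => //; try level_arith.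
    by rewrite /upward (outer_sym _ e_sym) aw E eqxx.
  have wa : outer w a by rewrite (outer_sym _ e_sym).
  have ca : outer_color w a = h a %% 3.
    rewrite /outer_color; have -> : (h a == (h w).+1) = false by apply/eqP; level_arith.
    by have -> : (h w == (h a).+1) = false; [apply/eqP; level_arith|congr (_ %% _); level_arith].
  have ed := escape_direct dD.
  (* Since [wa] has the color of the level of [a], the path can start at [w] unless the residues of
     [w] and [a] agree; then it starts at an upper neighbour of [w]. *)
  have [w1|[w2|w0]] : h w %% 3 = (h a + 1) %% 3 \/ h w %% 3 = (h a + 2) %% 3 \/
                      h w %% 3 = h a %% 3 by level_arith.
  - have ew : escape w [:: a] (h w) by apply: escape_edge => //; rewrite ca; level_arith.
    have ep := escape_up pb.
    by_escapes [:: (d, [::] : seq T, h d); (p, [:: b], h p); (w, [:: a], h w)].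
  - have ew : escape w [:: a] (h w) by apply: escape_edge => //; rewrite ca; level_arith.
    have eg := escape_up2 gp pb.
    by_escapes [:: (d, [::] : seq T, h d); (g, [:: p; b], h g); (w, [:: a], h w)].
  - have /summitPn[c wc] := sw; have [owc hc _ _] := upwardP wc.
    have ec : escape c [:: w; a] (h c).
      apply: escape_edge2; rewrite 1?(outer_sym _ e_sym) //.
      + by apply/eqP => E; subst c; level_arith.
      + by rewrite outer_colorC upward_color //; level_arith.
      + by rewrite outer_colorC upward_color // ca; level_arith.
    have ep := escape_up pb.
    by_escapes [:: (d, [::] : seq T, h d); (p, [:: b], h p); (c, [:: w; a], h c)].
(* With [p] as its only neighbour outside [D], [a] would have two legs. *)
exfalso; have : 3 <= size (legs a) + 1; last by level_arith.
apply: (@degree_split a [:: p]) => // y ay; rewrite inE.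
by have := none y; rewrite ay => /negbFE.
Qed.

(** Each summit has a leg colored one above its level or a descent of two levels. One such leg
    suffices; failing that, two different lower neighbours do; what remains is a lower neighbour
    common to all three. *)
Lemma cover3_summits a b d :
  a \notin D -> b \notin D -> d \notin D -> a != b -> a != d -> b != d ->
  h a %% 3 = h b %% 3 -> h d %% 3 = h b %% 3 ->
  peak a -> peak b -> peak d -> cover [:: a; b; d].
Proof.
move=> aD bD dD nab nad nbd ab db sa sb sd.
have opt y : y \notin D -> peak y -> escape y [::] (h y + 1) \/ exists p g, up p y /\ up g p.
  move=> yD sy; case: (escape_plus yD) => [[c yc]||]; [|by left|by right].
  by move/forallP/(_ c): sy; rewrite yc.
case: (opt a aD sa) => [ea|[p [g [pa gp]]]]; first exact: cover3_summit_leg.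
case: (opt b bD sb) => [eb|[q [g' [qb gq]]]].
  permute [:: b; a; d].
  by apply: cover3_summit_leg => //; rewrite 1?eq_sym ?db ?ab.
have [pq|npq] := eqVneq p q; last exact: (cover3_distinct_parents (p := p) (q := q) (g := g')).
subst q; case: (opt d dD sd) => [ed|[q [g'' [qd gq']]]].
  permute [:: d; b; a].
  by apply: cover3_summit_leg => //; rewrite 1?eq_sym.
have [pq|npq] := eqVneq p q; last first.
  permute [:: a; d; b].
  by apply: (cover3_distinct_parents (p := p) (q := q) (g := g'')) => //; rewrite 1?eq_sym ?db.
subst q; case: (cover3_common_parent nab nad nbd sa pa qb qd gp) => // ea.
exact: cover3_summit_leg.
Qed.

(** [z] takes color 0 and [y] color 1 through [c], so [x] needs color 2, by a leg or by a climb of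
    two levels avoiding [c]. *)
Lemma cover3_roots x y z :
  x \notin D -> z \notin D -> x != y -> x != z -> y != z ->
  h x = 0 -> h y = 0 -> h z = 0 -> ~~ peak y -> cover [:: x; y; z].
Proof.
move=> xD zD nxy nxz nyz hx hy hz /summitPn[c yc].
have ez := escape_direct zD; have ec := escape_down yc; have [_ hc _ _] := upwardP yc.
have [sx|/summitPn[c1 xc1]] := boolP (peak x).
  have [_ ex] := root_summit_escape xD hx sx.
  by_escapes [:: (z, [::] : seq T, h z); (c, [:: y], h c); (x, [::], h x + 2)].
have [c' xc' ncc'] : exists2 c', up x c' & c' != c.
  have [E|] := eqVneq c1 c; last by exists c1.
  by subst c1; apply: (second_up_neighbor e_sym e_irr h_max nxy).
have [_ hc' _ _] := upwardP xc'.
case: (root_escape hx xc') => [ex|[g cg]].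
  by_escapes [:: (z, [::] : seq T, h z); (c, [:: y], h c); (x, [::], h x + 2)].
have eg := escape_down2 xc' cg; have [_ hg _ _] := upwardP cg.
by_escapes [:: (z, [::] : seq T, h z); (c, [:: y], h c); (g, [:: c'; x], h g)].
Qed.

(** [y] can go up, so [x] or [z] of positive level goes down. If both have level 0, then either [y]
    does too, or [y] goes down while one of them goes up, or both are summits and use their legs. *)
Lemma cover3_not_summit x y z :
  x \notin D -> y \notin D -> z \notin D -> x != y -> x != z -> y != z ->
  h x %% 3 = h y %% 3 -> h z %% 3 = h y %% 3 -> ~~ peak y -> cover [:: x; y; z].
Proof.
move=> xD yD zD nxy nxz nyz xy zy sy.
have [hx|hx] := posnP (h x); last first.
  permute [:: y; x; z].
  by apply: cover3_up_down => //; rewrite 1?eq_sym // ?zy ?xy.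
have [hz|hz] := posnP (h z); last first.
  permute [:: y; z; x].
  by apply: cover3_up_down => //; rewrite 1?eq_sym // ?zy ?xy.
have [hy|hy] := posnP (h y); first exact: cover3_roots.
have [sx|sx] := boolP (peak x); last by apply: cover3_up_down.
have [sz|sz] := boolP (peak z); last first.
  permute [:: z; y; x].
  by apply: cover3_up_down => //; rewrite 1?eq_sym.
have [ex _] := root_summit_escape xD hx sx; have [_ ez] := root_summit_escape zD hz sz.
have ey := escape_direct yD.
by_escapes [:: (y, [::] : seq T, h y); (x, [::], h x + 1); (z, [::], h z + 2)].
Qed.

Lemma cover3 x y z :
  x \notin D -> y \notin D -> z \notin D -> x != y -> x != z -> y != z ->
  cover [:: x; y; z].
Proof.
move=> xD yD zD nxy nxz nyz.
have [xy|Nxy] := eqVneq (h x %% 3) (h y %% 3); last first.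
  have [xz|Nxz] := eqVneq (h x %% 3) (h z %% 3).
    permute [:: x; z; y].
    by apply: cover3_two_classes; rewrite // -xz eq_sym.
  have [yz|Nyz] := eqVneq (h y %% 3) (h z %% 3).
    permute [:: y; z; x].
    exact: cover3_two_classes.
  have ex := escape_direct xD; have ey := escape_direct yD; have ez := escape_direct zD.
  by_escapes [:: (x, [::] : seq T, h x); (y, [::], h y); (z, [::], h z)].
have [zy|Nzy] := eqVneq (h z %% 3) (h y %% 3); last exact: cover3_two_classes.
have [sy|sy] := boolP (peak y); last exact: cover3_not_summit.
have [sx|sx] := boolP (peak x); last first.
  permute [:: y; x; z].
  by apply: cover3_not_summit; rewrite // 1?eq_sym ?zy ?xy.
have [sz|sz] := boolP (peak z); last first.
  permute [:: x; z; y].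
  by apply: cover3_not_summit; rewrite // 1?eq_sym ?zy ?xy.
exact: cover3_summits.
Qed.

Lemma cover_small A : uniq A -> all (fun x => x \notin D) A -> size A <= 3 -> cover A.
Proof.
case: A => [|x [|y [|z [|//]]]] /=.
- by move=> *; exists [::]; split.
- by move=> _ /andP[xD _] _; apply: cover1.
- by rewrite inE !andbT => nxy /andP[xD yD] _; apply: cover2.
- rewrite !inE negb_or !andbT => /andP[/andP[nxy nxz] nyz] /and3P[xD yD zD] _.
  exact: cover3.
Qed.

(** * Assembling the proper tree *)

Lemma proper_tree_ext W F :
  is_subtree e D W F -> proper_edges c0 F -> proper_tree e ext_coloring W F.
Proof.
case/and5P=> WD W0 /forall_inP HF cF conn /forall_inP prop.
have cE f : f \in F -> ext_coloring f = c0 f.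
  move/HF/exists_inP => [x /(subsetP WD) xD /exists_inP[y /(subsetP WD) yD /andP[_ /eqP->]]].
  by apply: val_inj; rewrite /= ext_coloringE /ext_color xD yD.
apply/andP; split; first by apply/and5P; split=> //; apply/forall_inP.
apply/forall_inP => f fF; apply/forall_inP => g gF; rewrite !cE //.
by have /forall_inP/(_ g gF) := prop f fF.
Qed.

Lemma ext_coloring_proper : three_proper_with e D k c0 ->
  three_proper_with e [set: T] (k + 3) ext_coloring.
Proof.
move=> c0P; have c0k f : is_edge e D f -> c0 f < k.
  by case/andP: c0P => /forallP/(_ f)/implyP.
apply/andP; split.
  apply/forallP => f; apply/implyP => /exists_inP[x _ /exists_inP[y _ /andP[exy /eqP->]]].
  rewrite ext_coloringE /ext_color.
  case: ifP => xD; case: ifP => yD; last 3 first.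
  - by rewrite ltn_add2l ltn_mod.
  - by rewrite ltn_add2l ltn_mod.
  - by rewrite ltn_add2l ltn_mod.
  apply: ltn_addr; apply: c0k; apply/exists_inP; exists x => //.
  by apply/exists_inP; exists y => //; rewrite exy eqxx.
apply/forallP => S; apply/implyP => /andP[_ cardS].
have {}cardS : #|S| <= 3.
  move: cardS; case: ifP => [_ /eqP-> //|small _].
  by have := subset_leq_card (subsetT S); lia.
have [||bs [szb br [ucol colk] uv sub]] := @cover_small (enum (S :\: D)) (enum_uniq _).
- by apply/allP => x; rewrite mem_enum inE => /andP[].
- by rewrite -cardE; apply: leq_trans cardS; apply: subset_leq_card (subsetDl _ _).
(* Entry points replace the vertices of [S] outside [D], at most one for each, so [X] has at most
   three elements. *)
pose X := (S :&: D) :|: [set u in map (fun b => b.1.1) bs].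
have brD b : b \in bs -> b.1.1 \in D.
  by move=> bb; have /allP/(_ b bb)/and5P[] := br.
have XD : X \subset D.
  apply/subsetP => u; rewrite !inE => /orP[/andP[]//|/mapP[b bb ->]].
  exact: brD.
have cardX : #|X| <= 3.
  apply: leq_trans cardS; rewrite -(cardsID D S).
  apply: leq_trans (leq_card_setU _ _) _; rewrite leq_add2l (cardE (S :\: D)).
  apply: leq_trans szb; rewrite cardsE -(size_map (fun b => b.1.1)).
  exact: card_size.
have [W [F [WF pF XW]]] := three_proper_small c0P XD cardX.
have t := proper_tree_ext WF pF; have WD : W \subset D by case/and5P: WF.
have [|||W' [F' [/andP[t' p'] WW' all']]] := attach_branches t br _ ucol uv.
- move=> b bb; apply: (subsetP XW); rewrite !inE; apply/orP; right.
  exact: map_f bb.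
- move=> x /flattenP[l /mapP[b bb ->]] xb.
  have /allP/(_ b bb)/and5P[_ /allP/(_ x xb) xD _ _ _] := br.
  by apply: contraNN xD; apply/subsetP.
(* Tree edges in [D] have colors below [k], first edges of branches do not. *)
- move=> f u fF uD uf; apply/mapP => -[b bb cb].
  have lo := colk b bb; have : c0 f < k.
    apply: c0k; have [x [y [xW yW exy ->]]] := proper_tree_edge t fF.
    apply/exists_inP; exists x; first exact: (subsetP WD).
    by apply/exists_inP; exists y; rewrite ?exy ?eqxx //; apply: (subsetP WD).
  have -> : c0 f = ext_coloring f.
    have [x [y [/(subsetP WD) xD /(subsetP WD) yD exy ->]]] := proper_tree_edge t fF.
    by apply: val_inj; rewrite /= ext_coloringE /ext_color xD yD.
  by rewrite cb ltnNge lo.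
apply/existsP; exists W'; apply/existsP; exists F'; apply/and3P; split=> //.
apply/subsetP => x xS; case xD: (x \in D).
  by apply: (subsetP WW'); apply: (subsetP XW); rewrite !inE xS xD.
by apply: all'; apply: sub; rewrite mem_enum inE xD.
Qed.

End ExtendedColoring.

(** * The minimum defining [px3] *)

Lemma px3_le_palette (T : finType) (e : rel T) V : px3 e V <= palette T.
Proof. by rewrite /px3; elim/big_rec: _ => // k m _ H; rewrite geq_min H orbT. Qed.

Lemma px3_min (T : finType) (e : rel T) V k : colorable3 e V k -> px3 e V <= k.
Proof.
move=> ck; have [kp|kp] := leqP k (palette T); last first.
  exact: leq_trans (px3_le_palette e V) (ltnW kp).
have := mem_index_enum (Ordinal (kp : k < (palette T).+1)); rewrite /px3.
elim: (index_enum _) => // j r IH; rewrite big_cons inE => /orP[/eqP<-|/IH le].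
  by rewrite ck geq_minl.
by case: ifP => // _; rewrite geq_min le orbT.
Qed.

(** The minimum has the default [palette T]; a smaller value comes from an admissible [k]. *)
Lemma px3_colorable (T : finType) (e : rel T) V :
  px3 e V < palette T -> colorable3 e V (px3 e V).
Proof.
rewrite /px3; elim/big_ind: _ => [|a b Ha Hb|k ck _]; rewrite ?ltnn //.
by case: (leqP a b) => ab; [move/Ha|move/Hb].
Qed.

Lemma px3_dominating (T : finType) (e : rel T) (D : {set T}) :
  symmetric e -> irreflexive e -> three_way_dominating e D ->
  px3 e [set: T] <= px3 e D + 3.
Proof.
(* If the palette has no room for three further colors, the bound follows from [px3] never exceeding
   the palette. *)
move=> e_sym e_irr [dom deg]; have [big|small] := leqP (px3 e D + 3) (palette T); last first.
  exact: leq_trans (px3_le_palette _ _) (ltnW small).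
have /existsP[c cP] : colorable3 e D (px3 e D) by apply: px3_colorable; lia.
have [h hmax] := max_leveling_exists e D.
apply: px3_min; apply/existsP.
exists (ext_coloring e D h (px3 e D) c).
exact: ext_coloring_proper.
Qed.

(** * Cliques glued at a vertex *)

Section GluedCliques.
Variables (p : nat) (i : 'I_p -> nat).
Hypothesis i_ge4 : forall j, 4 <= i j.

Local Notation V := (glued_vertex i).
Local Notation e := (glued_rel i).

Lemma glued_sym : symmetric e.
Proof. by move=> [u|] [v|] //=; rewrite eq_sym [u == v]eq_sym. Qed.

Lemma glued_irr : irreflexive e.
Proof. by move=> [u|] //=; rewrite !eqxx. Qed.

Lemma glued_connected : connected_graph e.
Proof.
split; first by rewrite card_option.
have toN x : connect e x None by case: x => [u|] //; apply: connect1.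
move=> x y; apply: connect_trans (toN x) _.
by rewrite (sym_connect_sym glued_sym).
Qed.

Lemma glued_center_connected : connected_set e [set None].
Proof.
split; first by apply/set0Pn; exists None; rewrite inE.
by move=> x y /set1P-> /set1P->; apply: connect0.
Qed.

Lemma glued_center_dominating : three_way_dominating e [set None].
Proof.
split=> [[u|]|[[j a]|]]; rewrite ?inE ?eqxx //; first by exists None; rewrite ?inE.
(* The center takes the place of the vertex itself, which gives [i j - 1] neighbours. *)
move=> _; pose f (b : 'I_(i j).-1) : V :=
  if b == a then None else Some (Tagged (fun j => 'I_(i j).-1) b).
have f_inj : injective f.
  move=> b b'; rewrite /f; case: (eqVneq b a) => [->|_]; case: (eqVneq b' a) => [->|_] //.
  by case=> /eqP; rewrite eq_Tagged /= => /eqP.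
apply: (@leq_trans #|f @: setT|).
  by rewrite card_imset // cardsT card_ord; have := i_ge4 j; lia.
apply: subset_leq_card; apply/subsetP => _ /imsetP[b _ ->]; rewrite inE /f.
by case: (eqVneq b a) => //= nba; rewrite eqxx eq_Tagged eq_sym.
Qed.

Lemma glued_px3_center : px3 e [set None] = 0.
Proof.
apply/eqP; rewrite -leqn0; apply: px3_min.
(* Even without edges, a coloring needs some color to take as its value. *)
have p0 : 0 < palette V by rewrite /palette; apply/card_gt0P; exists set0.
apply/existsP; exists [ffun=> Ordinal p0]; apply/andP; split.
  apply/forallP => f; apply/implyP => /exists_inP[x /set1P-> /exists_inP[y /set1P->]].
  by [].
apply/forallP => S; apply/implyP => /andP[SN _].
apply/existsP; exists [set None]; apply/existsP; exists set0; apply/and3P; split=> //.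
  apply/and5P; split=> //.
  - by apply/set0Pn; exists None; rewrite inE.
  - by apply/forall_inP => f; rewrite inE.
  - by rewrite cards0 cards1.
  - apply/forall_inP => x /set1P->; apply/forall_inP => y /set1P->.
    exact: connect0.
by apply/forall_inP => f; rewrite inE.
Qed.

Lemma clique_size_gt0 j : 0 < (i j).-1.
Proof. by have := i_ge4 j; lia. Qed.

Definition clique_vertex (j : 'I_p) : V :=
  Some (Tagged (fun j => 'I_(i j).-1) (Ordinal (clique_size_gt0 j))).

Definition in_clique (j : 'I_p) (x : V) : bool :=
  if x is Some u then tag u == j else false.

(* Only the center is adjacent to vertices of several cliques. *)
Lemma glued_leave_clique W F j x y :
  is_subtree e [set: V] W F -> x \in W -> y \in W -> in_clique j x -> ~~ in_clique j y ->
  exists2 u, in_clique j u & [set None; u] \in F.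
Proof.
case/and5P=> _ _ /forall_inP HF _ /forall_inP conn xW yW.
have /forall_inP/(_ y yW)/connectP[s] := conn x xW.
elim: s x {xW} => [|z s IH] x /=; first by move=> _ -> ->.
case/andP=> xz ps ly jx njy; case jz: (in_clique j z); first exact: IH ps ly jz njy.
exists x => //; suff zN : z = None by rewrite zN setUC in xz.
have /exists_inP[a _ /exists_inP[b _ /andP[eab /eqP E]]] := HF _ xz.
have {eab} : e x z.
  by case: (set2_eq E) => -[-> ->]; rewrite // glued_sym.
case: z x jx jz {IH xz ps ly E} => // v [u|] //= /eqP uj vj /andP[/eqP uv _].
by rewrite -uv uj eqxx in vj.
Qed.

Hypothesis p_ge3 : 3 <= p.

Lemma glued_px3_ge3 : 3 <= px3 e [set: V].
Proof.
rewrite leqNgt; apply/negP => lt3.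
pose j0 : 'I_p := Ordinal (leq_trans (isT : 0 < 3) p_ge3).
pose j1 : 'I_p := Ordinal (leq_trans (isT : 1 < 3) p_ge3).
pose j2 : 'I_p := Ordinal (leq_trans (isT : 2 < 3) p_ge3).
have n01 : j0 != j1 by []. have n02 : j0 != j2 by []. have n12 : j1 != j2 by [].
pose S := [set clique_vertex j0; clique_vertex j1; clique_vertex j2].
have cjj j : in_clique j (clique_vertex j) by rewrite /= eqxx.
have cjk j l : j != l -> ~~ in_clique l (clique_vertex j) by [].
have cn j l : j != l -> clique_vertex j != clique_vertex l.
  by move=> njl; apply: contraNneq (cjk _ _ njl) => ->.
have cS : #|S| = 3.
  by rewrite /S setUC cardsU1 cards2 !inE negb_or cn // cn // cn.
(* Singletons show that the palette has at least [#|V|], hence three colors, so a value below 3 is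
   not the default and is attained. *)
have big : px3 e [set: V] < palette V.
  apply: leq_trans lt3 _; apply: leq_trans (leq_card _ (@set1_inj V)).
  by rewrite -cS -cardsT; apply: subset_leq_card (subsetT S).
have /existsP[c cP] := px3_colorable big.
have [W [F [WF pF SW]]] := three_proper_small cP (subsetT S) (eq_leq cS).
have sW j : j \in [:: j0; j1; j2] -> clique_vertex j \in W.
  by move=> jj; apply: (subsetP SW); move: jj; rewrite !inE => /or3P[] /eqP->; rewrite eqxx ?orbT.
(* The tree must leave each of the three cliques, which forces an edge from it to the center. *)
have star j l : j \in [:: j0; j1; j2] -> l \in [:: j0; j1; j2] -> l != j ->
    exists2 u, in_clique j u & [set None; u] \in F.
  move=> jj ll nlj.
  exact: (glued_leave_clique WF (sW j jj) (sW l ll) (cjj j) (cjk l j nlj)).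
have [|||u0 c0 F0] := star j0 j1 => //.
have [|||u1 c1 F1] := star j1 j0 => //.
have [|||u2 c2 F2] := star j2 j0 => //.
have lt2 u : [set None; u] \in F -> c [set None; u] < 2.
  move=> uF; apply: leq_trans (_ : _ < px3 e [set: V]) _; last by [].
  case/andP: cP => /forallP/(_ [set None; u])/implyP H _; apply: H.
  case/and5P: WF => _ _ /forall_inP/(_ _ uF)/exists_inP[x _ /exists_inP[y _ H]] _ _.
  by apply/exists_inP; exists x => //; apply/exists_inP; exists y.
have diff j l u v : in_clique j u -> in_clique l v -> j != l ->
    [set None; u] \in F -> [set None; v] \in F -> (c [set None; u] != c [set None; v] :> nat).
  move=> ju lv njl uF vF; have /forall_inP/(_ _ vF)/implyP := forall_inP pF _ uF.
  rewrite val_eqE; apply; apply/andP; split.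
    apply/eqP => /set2_eq[[_ E]|[E1 E2]].
      by move: lv ju; rewrite -E; case: u {uF E} => //= u /eqP-> /eqP E; rewrite E eqxx in njl.
    by rewrite E2 in ju.
  by apply/set0Pn; exists None; rewrite !inE eqxx.
have := diff _ _ _ _ c0 c1 n01 F0 F1; have := diff _ _ _ _ c0 c2 n02 F0 F2.
have := diff _ _ _ _ c1 c2 n12 F1 F2.
have := lt2 _ F0; have := lt2 _ F1; have := lt2 _ F2.
by case: (nat_of_ord _) => [|[|]] //; case: (nat_of_ord _) => [|[|]] //; case: (nat_of_ord _) => [|[|]].
Qed.

End GluedCliques.

Theorem theorem3p1 :
  (forall (T : finType) (e : rel T) (D : {set T}),
      symmetric e -> irreflexive e ->
      connected_graph e ->
      connected_set e D -> three_way_dominating e D ->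
      px3 e [set: T] <= px3 e D + 3)
  /\
  (forall (p : nat) (i : 'I_p -> nat),
      3 <= p -> (forall j, 4 <= i j) ->
      connected_graph (glued_rel i) /\
      connected_set (glued_rel i) [set None] /\
      three_way_dominating (glued_rel i) [set None] /\
      px3 (glued_rel i) [set: glued_vertex i] = 3 /\
      px3 (glued_rel i) [set: glued_vertex i] = px3 (glued_rel i) [set None] + 3).
Proof.
split=> [T e D e_sym e_irr _ _ domD|p i p3 i4]; first exact: px3_dominating.
have dom := glued_center_dominating i4.
have px : px3 (glued_rel i) [set: glued_vertex i] = 3.
  apply/eqP; rewrite eqn_leq glued_px3_ge3 // andbT.
  (* The upper bound is the general inequality for the single vertex [None], where [px3] is 0. *)
  have := px3_dominating (@glued_sym _ i) (@glued_irr _ i) dom.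
  by rewrite glued_px3_center.
rewrite px glued_px3_center; split; first exact: glued_connected.
by split; first exact: glued_center_connected.
Qed.
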